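(* Let $\mathbb{K}=(K_1,K_2,K_3,I)$ be a triadic formal context and let $\mathcal{T}$ be the system of all trisets of $\mathbb{K}$. Suppose there exist two distinct triconcepts $c_1=(X_1,Y_1,Z_1)$ and $c_2=(X_1,Y_2,Z_2)$ of $\mathbb{K}$ whose common maximal switching generator $s=(X_1\cap X_1,\,Y_1\cap Y_2,\,Z_1\cap Z_2)$ is non-empty (i.e. not all three of its components are empty). Then there is no closure operator associated with $\mathcal{T}$, that is, there is no map $\sigma:\mathcal{T}\to\mathcal{T}$ that is extensive, monotone and idempotent with respect to $\leq$ and whose set of closed elements $\{t\in\mathcal{T}\mid\sigma(t)=t\}$ is exactly the set of triconcepts of $\mathbb{K}$.
   Context: A triadic formal context $\mathbb{K}=(K_1,K_2,K_3,I)$ consists of sets $K_1,K_2,K_3$ and a relation $I\subseteq K_1\times K_2\times K_3$. A triset of $\mathbb{K}$ is a triple $(X,Y,Z)\in 2^{K_1}\times 2^{K_2}\times 2^{K_3}$ with $X\times Y\times Z\subseteq I$ (components may be empty). Triples are ordered by inclusion of their set representations: $(X,Y,Z)\leq(X',Y',Z')$ iff $X\subseteq X'$, $Y\subseteq Y'$ and $Z\subseteq Z'$. A triconcept of $\mathbb{K}$ is a triset that is maximal with respect to $\leq$ among all trisets of $\mathbb{K}$. The maximal switching generator of two distinct triconcepts is their componentwise intersection. *)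

(* Defs.v *)
From mathcomp Require Import all_boot all_order.
From mathcomp Require Import boolp classical_sets.

Set Implicit Arguments.
Unset Strict Implicit.
Unset Printing Implicit Defensive.

Local Open Scope classical_set_scope.

(* A triadic context is given by the types K1, K2, K3 (the three sets, of any
   cardinality, possibly empty) and I : set (K1 * K2 * K3). *)

Definition triple (K1 K2 K3 : Type) : Type := (set K1 * set K2 * set K3)%type.

Section TriadicContext.
Context {K1 K2 K3 : Type}.
Implicit Types (I : set (K1 * K2 * K3)) (s t : triple K1 K2 K3).

Definition triple_le s t : Prop :=
  [/\ s.1.1 `<=` t.1.1, s.1.2 `<=` t.1.2 & s.2 `<=` t.2].

Definition trisets I : set (triple K1 K2 K3) :=
  [set t | t.1.1 `*` t.1.2 `*` t.2 `<=` I].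

Definition triconcepts I : set (triple K1 K2 K3) :=
  [set t | trisets I t /\
     forall t', trisets I t' -> triple_le t t' -> t' = t].

Definition max_switching_generator s t : triple K1 K2 K3 :=
  (s.1.1 `&` t.1.1, s.1.2 `&` t.1.2, s.2 `&` t.2).

(* A triple is empty when all three components are; a single empty component
   does not make it empty. *)
Definition triple_nonempty t : Prop :=
  ~ [/\ t.1.1 = set0, t.1.2 = set0 & t.2 = set0].

End TriadicContext.

Definition closure_operator (T : Type) (le : T -> T -> Prop) (sigma : T -> T)
    : Prop :=
  [/\ forall t, le t (sigma t),
      forall t u, le t u -> le (sigma t) (sigma u)
    & forall t, sigma (sigma t) = sigma t].

Definition closed_elements (T : Type) (sigma : T -> T) : set T :=
  [set t | sigma t = t].

(* sigma acts on the subtype of trisets; its closed elements are compared with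
   the triconcepts as sets of triples. *)
Definition associated_closure_operator (K1 K2 K3 : Type)
    (I : set (K1 * K2 * K3)) (sigma : trisets I -> trisets I) : Prop :=
  closure_operator (fun t u : trisets I => triple_le (val t) (val u)) sigma /\
  [set val t | t in closed_elements sigma] = triconcepts I.

(* Main.v *)
(** Triconcepts are maximal, hence pairwise incomparable. The closure of the
    generator [s] would be a triconcept, and by monotonicity it would lie below
    both [c1] and [c2], so it would equal both. *)

Require Import Defs.
From mathcomp Require Import all_boot all_order.
From mathcomp Require Import boolp classical_sets.

Local Open Scope classical_set_scope.

(** Shrinking the components shrinks the box; this places the switching generator in the domain of
    [sigma]. *)
Lemma trisets_le {K1 K2 K3 : Type} {I : set (K1 * K2 * K3)}
    {s t : triple K1 K2 K3} :
  triple_le s t -> trisets I t -> trisets I s.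
Proof.
move=> [s1 s2 s3] It [[x y] z] [[/= /s1 tx /s2 ty] /s3 tz].
by apply: It.
Qed.

Lemma max_switching_generator_lel {K1 K2 K3 : Type} (s t : triple K1 K2 K3) :
  triple_le (max_switching_generator s t) s.
Proof. by split; apply: subIsetl. Qed.

Lemma max_switching_generator_ler {K1 K2 K3 : Type} (s t : triple K1 K2 K3) :
  triple_le (max_switching_generator s t) t.
Proof. by split; apply: subIsetr. Qed.

(** Idempotence makes [sigma s] closed, hence a triconcept. As [c] is a fixed point, monotonicity
    puts [sigma s] below it. *)
Lemma triconcept_eq_closure {K1 K2 K3 : Type} {I : set (K1 * K2 * K3)}
    {sigma : trisets I -> trisets I} {s : trisets I} {c : triple K1 K2 K3} :
  associated_closure_operator sigma -> triconcepts I c ->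
  triple_le (val s) c -> c = val (sigma s).
Proof.
move=> [[_ mono idem] closedE] Ic.
have : [set val t | t in closed_elements sigma] c by rewrite closedE.
move=> [u sigma_u uc] le_sc.
have [_ max_s] : triconcepts I (val (sigma s)).
  by rewrite -closedE; exists (sigma s) => //; apply: idem.
(* The maximality used is that of [sigma s]: [c] only has to be a triset above it. *)
apply: max_s; first exact: Ic.1.
rewrite -{}uc in le_sc *.
by rewrite -sigma_u; apply: mono.
Qed.

Theorem theorem4 (K1 K2 K3 : Type) (I : set (K1 * K2 * K3))
    (X1 : set K1) (Y1 Y2 : set K2) (Z1 Z2 : set K3)
    (hc1 : triconcepts I (X1, Y1, Z1))
    (hc2 : triconcepts I (X1, Y2, Z2))
    (hne : (X1, Y1, Z1) <> (X1, Y2, Z2))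
    (hs : triple_nonempty
            (max_switching_generator (X1, Y1, Z1) (X1, Y2, Z2))) :
  ~ exists sigma : trisets I -> trisets I, associated_closure_operator sigma.
Proof.
move=> [sigma assoc]; apply: hne.
set c1 := (X1, Y1, Z1) in hc1 *; set c2 := (X1, Y2, Z2) in hc2 *.
have le1 := max_switching_generator_lel c1 c2.
have le2 := max_switching_generator_ler c1 c2.
have Is := trisets_le le1 hc1.1.
(* The right-hand side [sigma s] does not depend on the triconcept, so one [s] serves both [c1] and
   [c2]. *)
pose s : trisets I := SigSub (mem_set Is).
exact: etrans (triconcept_eq_closure (s := s) assoc hc1 le1)
              (esym (triconcept_eq_closure (s := s) assoc hc2 le2)).
Qed.
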